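(* There is a deterministic algorithm that takes as input a straight-line program of length $L$ representing a $t$-nomial $f\in\mathbb{C}[x]$ and returns the monomial expansion of $f$. The complexity of the algorithm is of order $O(t^4L)$.
   Context: A $t$-nomial is a polynomial with at most $t$ non-zero terms. A straight-line program is a program of evaluation (a sequence of instructions) using constants, the input variable $x$, and the operations $+$, $-$, $\times$; its length is its number of instructions. *)

(* Defs.v *)
From HB Require Import structures.
From mathcomp Require Import all_boot all_order all_algebra.
From mathcomp Require Import complex reals.
Set Implicit Arguments.
Unset Strict Implicit.
Unset Printing Implicit Defensive.
Import Order.TTheory GRing.Theory Num.Theory.
Local Open Scope ring_scope.

(** * Straight-line programs and sparse polynomials *)

(* Instruction number k computes the k-th intermediate result; the operands of
   an arithmetic instruction are numbers of earlier instructions.  Fetching a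
   constant or the variable counts as an instruction. *)
Inductive slp_instr (F : Type) : Type :=
| SConst of F
| SVar
| SAdd of nat & nat
| SSub of nat & nat
| SMul of nat & nat.
Arguments SVar {F}.
Arguments SAdd {F}.
Arguments SSub {F}.
Arguments SMul {F}.

Definition slp (F : Type) : Type := seq (slp_instr F).

Definition slp_instr_wf (F : Type) (k : nat) (o : slp_instr F) : bool :=
  match o with
  | SConst _ | SVar => true
  | SAdd i j | SSub i j | SMul i j => (i < k)%N && (j < k)%N
  end.

Definition slp_wf (F : Type) (P : slp F) : bool :=
  (0 < size P)%N && all (fun k => slp_instr_wf k (nth SVar P k)) (iota 0 (size P)).

Definition slp_step (F : comNzRingType) (v : seq {poly F}) (o : slp_instr F) :
    seq {poly F} :=
  rcons v match o with
          | SConst c => c%:P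
          | SVar => 'X
          | SAdd i j => v`_i + v`_j
          | SSub i j => v`_i - v`_j
          | SMul i j => v`_i * v`_j
          end.

Definition slp_represents (F : comNzRingType) (P : slp F) (f : {poly F}) : Prop :=
  slp_wf P /\ last 0 (foldl (@slp_step F) [::] P) = f.

Definition nomial (F : comNzRingType) (t : nat) (f : {poly F}) : Prop :=
  (count (fun c : F => c != 0%R) f <= t)%N.

(* The list of the nonzero terms of f, as pairs (coefficient, exponent), in any
   order. *)
Definition monomial_expansion (F : comNzRingType) (e : seq (F * nat)) (f : {poly F}) :
    Prop :=
  [/\ uniq (unzip2 e), all (fun m => m.1 != 0) e & f = \sum_(m <- e) m.1 *: 'X^(m.2)].

(** * Algorithms: a random access machine over an ordered field of scalars

  An algorithm is a finite program, the same for all inputs.  It works on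
  finitely many unbounded arrays of scalars and finitely many unbounded arrays
  of natural numbers (for control, addresses and exponents), both named by
  literals of the program and addressed by natural number expressions.
  Scalars support field operations, equality tests and order tests; naturals
  support only addition, truncated subtraction and comparison, so neither
  unit-cost integer division nor a floor function on scalars is available.
  The only scalar literals are 0 and 1, and dividing by 0 yields 0. *)

Inductive nexp : Type :=
| NLit of nat
| NGet of nat & nexp          (* NGet a i : cell i of the natural array a *)
| NAdd of nexp & nexp
| NSub of nexp & nexp.

Inductive sexp : Type :=
| SZero
| SOne
| SGet of nat & nexp          (* SGet a i : cell i of the scalar array a *)
| SPlus of sexp & sexp
| SMinus of sexp & sexp
| STimes of sexp & sexp
| SDiv of sexp & sexp.

Inductive test : Type :=
| NEq of nexp & nexp
| NLe of nexp & nexp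
| SEq of sexp & sexp
| SLe of sexp & sexp
| TNot of test
| TAnd of test & test.

Inductive cmd : Type :=
| Skip
| NSet of nat & nexp & nexp   (* NSet a i e : a[i] := e, natural array a *)
| SSet of nat & nexp & sexp   (* SSet a i e : a[i] := e, scalar array a *)
| Seq of cmd & cmd
| If of test & cmd & cmd
| While of test & cmd.

Record state (F : Type) : Type := State {
  nmem : nat -> nat -> nat;
  smem : nat -> nat -> F
}.

Definition upd (T : Type) (m : nat -> nat -> T) (a i : nat) (x : T) :
    nat -> nat -> T :=
  fun b j => if (b == a) && (j == i) then x else m b j.

Fixpoint neval (F : Type) (s : state F) (e : nexp) : nat :=
  match e with
  | NLit n => n
  | NGet a i => nmem s a (neval s i)
  | NAdd e1 e2 => (neval s e1 + neval s e2)%N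
  | NSub e1 e2 => (neval s e1 - neval s e2)%N
  end.

Fixpoint seval (F : numFieldType) (s : state F) (e : sexp) : F :=
  match e with
  | SZero => 0
  | SOne => 1
  | SGet a i => smem s a (neval s i)
  | SPlus e1 e2 => seval s e1 + seval s e2
  | SMinus e1 e2 => seval s e1 - seval s e2
  | STimes e1 e2 => seval s e1 * seval s e2
  | SDiv e1 e2 => seval s e1 / seval s e2
  end.

(* For F the complex numbers, x <= y is MathComp's partial order: it holds when
   y - x is a nonnegative real number. *)
Fixpoint teval (F : numFieldType) (s : state F) (b : test) : bool :=
  match b with
  | NEq e1 e2 => neval s e1 == neval s e2
  | NLe e1 e2 => (neval s e1 <= neval s e2)%N
  | SEq e1 e2 => seval s e1 == seval s e2
  | SLe e1 e2 => seval s e1 <= seval s e2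
  | TNot b1 => ~~ teval s b1
  | TAnd b1 b2 => teval s b1 && teval s b2
  end.

(* Unit cost: every node of every evaluated expression costs 1. *)
Fixpoint ncost (e : nexp) : nat :=
  match e with
  | NLit _ => 1
  | NGet _ i => (ncost i).+1
  | NAdd e1 e2 | NSub e1 e2 => (ncost e1 + ncost e2).+1
  end.

Fixpoint scost (e : sexp) : nat :=
  match e with
  | SZero | SOne => 1
  | SGet _ i => (ncost i).+1
  | SPlus e1 e2 | SMinus e1 e2 | STimes e1 e2 | SDiv e1 e2 =>
      (scost e1 + scost e2).+1
  end.

Fixpoint tcost (b : test) : nat :=
  match b with
  | NEq e1 e2 | NLe e1 e2 => (ncost e1 + ncost e2).+1
  | SEq e1 e2 | SLe e1 e2 => (scost e1 + scost e2).+1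
  | TNot b1 => (tcost b1).+1
  | TAnd b1 b2 => (tcost b1 + tcost b2).+1
  end.

(* [exec c s n s'] : started in s, the program c halts in s' at total cost n. *)
Inductive exec (F : numFieldType) : cmd -> state F -> nat -> state F -> Prop :=
| ExecSkip s : exec Skip s 1 s
| ExecNSet a i e s :
    exec (NSet a i e) s (ncost i + ncost e).+1
      (State (upd (nmem s) a (neval s i) (neval s e)) (smem s))
| ExecSSet a i e s :
    exec (SSet a i e) s (ncost i + scost e).+1
      (State (nmem s) (upd (smem s) a (neval s i) (seval s e)))
| ExecSeq c1 c2 s n1 s1 n2 s2 :
    exec c1 s n1 s1 -> exec c2 s1 n2 s2 -> exec (Seq c1 c2) s (n1 + n2)%N s2
| ExecIf b c1 c2 s n s' :
    exec (if teval s b then c1 else c2) s n s' ->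
    exec (If b c1 c2) s (tcost b + n)%N s'
| ExecWhileStop b c s :
    ~~ teval s b -> exec (While b c) s (tcost b) s
| ExecWhileStep b c s n1 s1 n2 s2 :
    teval s b -> exec c s n1 s1 -> exec (While b c) s1 n2 s2 ->
    exec (While b c) s (tcost b + n1 + n2)%N s2.

Lemma exec_deterministic (F : numFieldType) (c : cmd) (s : state F) n1 s1 n2 s2 :
  exec c s n1 s1 -> exec c s n2 s2 -> n1 = n2 /\ s1 = s2.
Proof.
move=> H; elim: H n2 s2 => {c s n1 s1}.
- by move=> s n2 s2 H; inversion H.
- by move=> a i e s n2 s2 H; inversion H.
- by move=> a i e s n2 s2 H; inversion H.
- move=> c1 c2 s n1 s1 m1 r1 _ IH1 _ IH2 n2 s2 H.
  inversion H as [| | |? ? ? ? ? ? ? E1 E2| | |]; subst.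
  by have [? ?] := IH1 _ _ E1; subst; have [? ?] := IH2 _ _ E2; subst.
- move=> b c1 c2 s n s' _ IH n2 s2 H.
  inversion H as [| | | |? ? ? ? ? ? E| |]; subst.
  by have [? ?] := IH _ _ E; subst.
- move=> b c s nb n2 s2 H.
  by inversion H as [| | | | | |? ? ? ? ? ? ? tb]; subst=> //; rewrite tb in nb.
- move=> b c s n1 s1 m1 r1 tb _ IH1 _ IH2 n2 s2 H.
  inversion H as [| | | | |? ? ? nb|? ? ? ? ? ? ? _ E1 E2]; subst.
    by rewrite tb in nb.
  by have [? ?] := IH1 _ _ E1; subst; have [? ?] := IH2 _ _ E2; subst.
Qed.

(** * Input and output conventions

  Input (P, t): natural array 0 holds the length of P and then t; cell k of
  natural arrays 1, 2, 3 holds the operation code and the two operands of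
  instruction k, and cell k of scalar array 0 its constant.  All other cells
  are 0.
  Output: cell 0 of natural array 0 holds the number of terms; cell k of scalar
  array 0 and of natural array 1 holds the k-th coefficient and exponent. *)

Definition slp_opcode (F : Type) (o : slp_instr F) : nat :=
  match o with
  | SConst _ => 0 | SVar => 1 | SAdd _ _ => 2 | SSub _ _ => 3 | SMul _ _ => 4
  end.

Definition slp_arg1 (F : Type) (o : slp_instr F) : nat :=
  match o with
  | SAdd i _ | SSub i _ | SMul i _ => i
  | _ => 0
  end.

Definition slp_arg2 (F : Type) (o : slp_instr F) : nat :=
  match o with
  | SAdd _ j | SSub _ j | SMul _ j => j
  | _ => 0
  end.

Definition slp_const (F : numFieldType) (o : slp_instr F) : F :=
  match o with
  | SConst c => c
  | _ => 0
  end.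

Definition input (F : numFieldType) (P : slp F) (t : nat) : state F :=
  State
    (fun a k => match a with
                | 0 => nth 0 [:: size P; t] k
                | 1 => nth 0 (map (@slp_opcode F) P) k
                | 2 => nth 0 (map (@slp_arg1 F) P) k
                | 3 => nth 0 (map (@slp_arg2 F) P) k
                | _ => 0
                end%N)
    (fun a k => if a == 0%N then (map (@slp_const F) P)`_k else 0).

Definition output (F : Type) (s : state F) : seq (F * nat) :=
  [seq (smem s 0 k, nmem s 1 k) | k <- iota 0 (nmem s 0 0)].

(* Main.v *)
(* Prony's method.  With s_i = f(2^i) for i < 2t, the exponents e of f give the
   nodes 2^e of the linear recurrence that (s_i) satisfies.  Gaussian elimination
   with pivoting on the t x (t+1) Hankel matrix of the s_i finds the monic
   polynomial of least degree that annihilates the sequence, namely the product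
   of the X - 2^e.  Its second coefficient is minus the sum of the 2^e, a number
   whose binary digits are the exponents, and they are read off greedily with
   the help of the numbers 2^(2^k), k <= L.  The coefficient of X^e is then
   sum_i q_i s_i / q(2^e), where q is the quotient of the annihilator by X - 2^e.
   This takes O(tL + t^3) operations. *)
Require Import Defs.
From HB Require Import structures.
From mathcomp Require Import all_boot all_order all_algebra.
From mathcomp Require Import complex reals zify ring.
Set Implicit Arguments.
Unset Strict Implicit.
Unset Printing Implicit Defensive.
Import Order.TTheory GRing.Theory Num.Theory.
Local Open Scope ring_scope.
Local Open Scope complex_scope.

(** * Counted loops *)

(** Only an upper bound [t] on the number m of terms is known, and leading minors of the Hankel
    matrix may vanish even below order m (already s_0 = f(1) for X - 1). So the matrix is never
    stored: row k of the elimination is a polynomial, begun as X^k and corrected until the pivot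
    functionals of the earlier rows vanish on it, where functional i sends q to the sum of the q_l
    s_(i+l). For k < m some functional survives, since a nonzero polynomial of degree k cannot
    vanish at m nodes; at k = m the row is forced to be the annihilator. The sum of the 2^e may have
    exponentially many binary digits in L, so they cannot be scanned one by one: each leading power
    of two is found by a binary search on its exponent, with L + 1 comparisons. All comparisons are
    between images of natural numbers, which the partial order on the complex numbers decides.
    Running times are bounded in a language of counted loops whose bounds are fixed beforehand, so
    that termination and cost follow from the syntax. *)

(* In [PFor v b c] the counter is cell 0 of the natural array v, and the number
   of rounds is cell 0 of the natural array b. *)
Inductive prog : Type :=
| PSkip
| PN of nat & nexp & nexp
| PS of nat & nexp & sexp
| PSeq of prog & prog
| PIf of test & prog & prog
| PFor of nat & nat & prog.

Definition cell (a : nat) : nexp := NGet a (NLit 0).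

Fixpoint compile (c : prog) : cmd :=
  match c with
  | PSkip => Skip
  | PN a i e => NSet a i e
  | PS a i e => SSet a i e
  | PSeq c1 c2 => Seq (compile c1) (compile c2)
  | PIf b c1 c2 => If b (compile c1) (compile c2)
  | PFor v b c =>
      Seq (NSet v (NLit 0) (NLit 0))
        (While (TNot (NLe (cell b) (cell v)))
          (Seq (compile c) (NSet v (NLit 0) (NAdd (cell v) (NLit 1)))))
  end.

Definition setn (F : Type) (s : state F) (a i x : nat) : state F :=
  State (upd (nmem s) a i x) (smem s).

Definition sets (F : Type) (s : state F) (a i : nat) (x : F) : state F :=
  State (nmem s) (upd (smem s) a i x).

Arguments setn : simpl never.
Arguments sets : simpl never.
Arguments nmem : simpl never.
Arguments smem : simpl never.

Lemma nmem_setn (F : Type) (s : state F) a i x b j :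
  nmem (setn s a i x) b j = if (b == a) && (j == i) then x else nmem s b j.
Proof. by []. Qed.

Lemma smem_setn (F : Type) (s : state F) a i x b j :
  smem (setn s a i x) b j = smem s b j.
Proof. by []. Qed.

Lemma nmem_sets (F : Type) (s : state F) a i (x : F) b j :
  nmem (sets s a i x) b j = nmem s b j.
Proof. by []. Qed.

Lemma smem_sets (F : Type) (s : state F) a i (x : F) b j :
  smem (sets s a i x) b j = if (b == a) && (j == i) then x else smem s b j.
Proof. by []. Qed.

(** The number of rounds is read once and the counter is set to [k.+1] rather than incremented. This
    agrees with [compile] when the body leaves both counter and bound alone, as [bounded_by]
    demands. *)
Fixpoint sem (F : numFieldType) (c : prog) (s : state F) : state F :=
  match c with
  | PSkip => s
  | PN a i e => setn s a (neval s i) (neval s e)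
  | PS a i e => sets s a (neval s i) (seval s e)
  | PSeq c1 c2 => sem c2 (sem c1 s)
  | PIf b c1 c2 => if teval s b then sem c1 s else sem c2 s
  | PFor v b c =>
      iteri (nmem s b 0) (fun k s' => setn (sem c s') v 0 k.+1) (setn s v 0 0)
  end.
Arguments sem : simpl never.

Fixpoint nwrites (c : prog) : seq nat :=
  match c with
  | PN a _ _ => [:: a]
  | PSeq c1 c2 | PIf _ c1 c2 => nwrites c1 ++ nwrites c2
  | PFor v _ c => v :: nwrites c
  | _ => [::]
  end.

Fixpoint swrites (c : prog) : seq nat :=
  match c with
  | PS a _ _ => [:: a]
  | PSeq c1 c2 | PIf _ c1 c2 => swrites c1 ++ swrites c2
  | PFor _ _ c => swrites c
  | _ => [::]
  end.

(* The loop bounds come from the arrays bs, which c leaves alone. *)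
Fixpoint bounded_by (bs : seq nat) (c : prog) : bool :=
  match c with
  | PSkip | PS _ _ _ => true
  | PN a _ _ => a \notin bs
  | PSeq c1 c2 | PIf _ c1 c2 => bounded_by bs c1 && bounded_by bs c2
  | PFor v b c =>
      [&& v \notin bs, b \in bs, v \notin nwrites c & bounded_by bs c]
  end.

(** In a loop, the test costs 6 and the increment 6, hence 12 per round; the initialisation costs 3
    and the last, failing test 6, hence 9. Charging both branches of a conditional keeps the bound
    polynomial. *)
Fixpoint cost_bound (rho : nat -> nat) (c : prog) : nat :=
  match c with
  | PSkip => 1
  | PN _ i e => (ncost i + ncost e).+1
  | PS _ i e => (ncost i + scost e).+1
  | PSeq c1 c2 => cost_bound rho c1 + cost_bound rho c2
  | PIf b c1 c2 => tcost b + (cost_bound rho c1 + cost_bound rho c2)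
  | PFor _ b c => rho b * (cost_bound rho c + 12) + 9
  end.

Section Semantics.
Variable F : numFieldType.
Implicit Types (s : state F) (c : prog).

Lemma sem_skip s : sem PSkip s = s. Proof. by []. Qed.
Lemma sem_n a i e s : sem (PN a i e) s = setn s a (neval s i) (neval s e).
Proof. by []. Qed.
Lemma sem_s a i e s : sem (PS a i e) s = sets s a (neval s i) (seval s e).
Proof. by []. Qed.
Lemma sem_seq c1 c2 s : sem (PSeq c1 c2) s = sem c2 (sem c1 s).
Proof. by []. Qed.
Lemma sem_if b c1 c2 s :
  sem (PIf b c1 c2) s = if teval s b then sem c1 s else sem c2 s.
Proof. by []. Qed.
Lemma sem_for v b c s :
  sem (PFor v b c) s =
  iteri (nmem s b 0) (fun k s' => setn (sem c s') v 0 k.+1) (setn s v 0 0).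
Proof. by []. Qed.

Lemma nmem_frame c s a i : a \notin nwrites c -> nmem (sem c s) a i = nmem s a i.
Proof.
elim: c s => [|b j e|b j e|c1 IH1 c2 IH2|b c1 IH1 c2 IH2|v b c IH] s //=.
- by rewrite inE sem_n nmem_setn => /negPf ->.
- by rewrite mem_cat negb_or => /andP[h1 h2]; rewrite sem_seq IH2 // IH1.
- by rewrite mem_cat negb_or => /andP[h1 h2]; rewrite sem_if; case: ifP => _; auto.
- rewrite inE negb_or => /andP[/negPf av ac].
  rewrite sem_for; elim: (nmem s b 0) => [|k IHk] /=; first by rewrite nmem_setn av.
  by rewrite nmem_setn av /= IH.
Qed.

Lemma smem_frame c s a i : a \notin swrites c -> smem (sem c s) a i = smem s a i.
Proof.
elim: c s => [|b j e|b j e|c1 IH1 c2 IH2|b c1 IH1 c2 IH2|v b c IH] s //=.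
- by rewrite inE sem_s smem_sets => /negPf ->.
- by rewrite mem_cat negb_or => /andP[h1 h2]; rewrite sem_seq IH2 // IH1.
- by rewrite mem_cat negb_or => /andP[h1 h2]; rewrite sem_if; case: ifP => _; auto.
- move=> ac; rewrite sem_for; elim: (nmem s b 0) => [|k IHk] //=.
  by rewrite smem_setn IH.
Qed.

Lemma nwrites_bounded bs c a : bounded_by bs c -> a \in bs -> a \notin nwrites c.
Proof.
elim: c => [|b j e|b j e|c1 IH1 c2 IH2|b c1 IH1 c2 IH2|v b c IH] //=.
- by rewrite inE => h ha; apply: contraNN h => /eqP <-.
- by case/andP=> h1 h2 ha; rewrite mem_cat negb_or IH1 ?IH2.
- by case/andP=> h1 h2 ha; rewrite mem_cat negb_or IH1 ?IH2.
- case/and4P=> h1 _ _ h2 ha; rewrite inE negb_or IH // andbT.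
  by apply: contraNN h1 => /eqP <-.
Qed.

Lemma exec_compile bs rho c s :
  bounded_by bs c -> (forall b, b \in bs -> nmem s b 0 = rho b) ->
  exists2 n, exec (compile c) s n (sem c s) & (n <= cost_bound rho c)%N.
Proof.
elim: c s => [|b j e|b j e|c1 IH1 c2 IH2|b c1 IH1 c2 IH2|v b c IH] s /=.
- by exists 1%N => //; constructor.
- by move=> _ _; eexists; [exact: ExecNSet|].
- by move=> _ _; eexists; [exact: ExecSSet|].
- case/andP=> ok1 ok2 hs; have [n1 e1 l1] := IH1 s ok1 hs.
  have [|n2 e2 l2] := IH2 (sem c1 s) ok2.
    by move=> b hb; rewrite nmem_frame ?hs // (nwrites_bounded ok1).
  by exists (n1 + n2)%N; [exact: ExecSeq e1 e2 | exact: leq_add].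
- case/andP=> ok1 ok2 hs; have [n1 e1 l1] := IH1 s ok1 hs.
  have [n2 e2 l2] := IH2 s ok2 hs; rewrite sem_if.
  case: ifPn => tb; [exists (tcost b + n1)%N | exists (tcost b + n2)%N]; try lia.
    by apply: ExecIf; rewrite tb.
  by apply: ExecIf; rewrite (negPf tb).
- case/and4P=> hv hb vc ok hs.
  have bv : (b == v) = false by apply: contraNF hv => /eqP <-.
  rewrite sem_for; set body := Seq (compile c) _; set w := While _ _.
  have loop d k s' : (k + d = rho b)%N -> nmem s' v 0 = k ->
      (forall b', b' \in bs -> nmem s' b' 0 = rho b') ->
      exists2 n, exec w s' n
        (iteri d (fun i r => setn (sem c r) v 0 (k + i).+1) s')
        & (n <= d * (cost_bound rho c + 12) + 6)%N.
    elim: d k s' => [|d IHd] k s' kd sv hs'.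
      exists 6%N => //=; apply: ExecWhileStop => /=.
      by rewrite negbK sv hs' // -kd addn0.
    have [n1 e1 l1] := IH s' ok hs'.
    set s1 := setn (sem c s') v 0 k.+1.
    have [||b' hb'|n2 e2 l2] := IHd k.+1 s1; first lia.
    + by rewrite nmem_setn !eqxx.
    + rewrite nmem_setn (_ : b' == v = false) ?nmem_frame ?hs' //.
        exact: nwrites_bounded hb'.
      by apply: contraNF hv => /eqP <-.
    exists (6 + (n1 + 6) + n2)%N; last by lia.
    (* [While] peels off its first round, [iteri] its last. Hence the claim for an arbitrary start
       [k], and here the first round is moved into the initial state. *)
    have -> : iteri d.+1 (fun i r => setn (sem c r) v 0 (k + i).+1) s' =
              iteri d (fun i r => setn (sem c r) v 0 (k.+1 + i).+1) s1.
      elim: {IHd l2 e2 kd} d => [|d IHd] /=; first by rewrite addn0.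
      by rewrite -IHd /= addSnnS.
    apply: (ExecWhileStep (n1 := (n1 + 6)%N) (s1 := s1)) e2 => /=.
      by rewrite sv hs' // -kd; lia.
    apply: ExecSeq e1 _; rewrite /s1 /setn.
    have -> : k.+1 = neval (sem c s') (NAdd (cell v) (NLit 1)).
      by rewrite /= nmem_frame // sv addn1.
    exact: (ExecNSet v (NLit 0) (NAdd (cell v) (NLit 1)) (sem c s')).
  have [|||n e l] := loop (rho b) 0%N (setn s v 0 0) => //.
  + by rewrite nmem_setn eqxx.
  + move=> b' hb'; rewrite nmem_setn (_ : b' == v = false) ?hs //.
    by apply: contraNF hv => /eqP <-.
  exists (3 + n)%N; last by lia.
  rewrite hs //; apply: ExecSeq e.
  exact: (ExecNSet v (NLit 0) (NLit 0) s).
Qed.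

(* The invariant I only has to speak about the arrays that c writes. *)
Lemma for_ind (I : nat -> state F -> Prop) v b c s N :
  v \notin nwrites c -> N = nmem s b 0 ->
  I 0%N (setn s v 0 0) ->
  (forall k r, (k < N)%N -> nmem r v 0 = k ->
     (forall a i, a \notin v :: nwrites c -> nmem r a i = nmem s a i) ->
     (forall a i, a \notin swrites c -> smem r a i = smem s a i) ->
     I k r -> I k.+1 (setn (sem c r) v 0 k.+1)) ->
  I N (sem (PFor v b c) s).
Proof.
move=> vc eN I0 IS; rewrite sem_for -eN.
pose J k r := [/\ nmem r v 0 = k,
  forall a i, a \notin v :: nwrites c -> nmem r a i = nmem s a i,
  forall a i, a \notin swrites c -> smem r a i = smem s a i & I k r].
suff: forall k, (k <= N)%N ->
    J k (iteri k (fun k s' => setn (sem c s') v 0 k.+1) (setn s v 0 0)).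
  by move/(_ N (leqnn N)); case.
elim=> [_|k IH kN] /=.
  split=> //; first by rewrite nmem_setn !eqxx.
  by move=> a i; rewrite inE negb_or nmem_setn => /andP[/negPf -> _].
have [h1 h2 h3 h4] := IH (ltnW kN); split; last exact: IS.
- by rewrite nmem_setn !eqxx.
- move=> a i ha; rewrite nmem_setn; move: (ha); rewrite inE negb_or => /andP[/negPf -> ac] /=.
  by rewrite nmem_frame // h2.
- by move=> a i ha; rewrite smem_setn smem_frame // h3.
Qed.

End Semantics.

(** * Values of a straight-line program *)

Section Values.
Variable F : comNzRingType.
Implicit Types P : slp F.

Definition slp_values P : seq {poly F} := foldl (@slp_step F) [::] P.

Definition slp_value (v : seq {poly F}) (o : slp_instr F) : {poly F} :=
  match o with
  | SConst c => c%:P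
  | SVar => 'X
  | SAdd i j => v`_i + v`_j
  | SSub i j => v`_i - v`_j
  | SMul i j => v`_i * v`_j
  end.

Lemma size_slp_values P : size (slp_values P) = size P.
Proof.
elim/last_ind: P => // P o IH.
by rewrite /slp_values foldl_rcons /slp_step !size_rcons -[in RHS]IH.
Qed.

(** Execution only appends values, and operands point backwards, so an instruction may be read
    against the final list instead of the list at the time it ran. *)
Lemma slp_valuesE P k :
  (forall k, (k < size P)%N -> slp_instr_wf k (nth SVar P k)) -> (k < size P)%N ->
  (slp_values P)`_k = slp_value (slp_values P) (nth SVar P k).
Proof.
elim/last_ind: P k => // P o IH k wf; rewrite size_rcons ltnS => kP.
have -> : slp_values (rcons P o) = rcons (slp_values P) (slp_value (slp_values P) o).
  by rewrite /slp_values foldl_rcons.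
set v := slp_values P in IH *; set w := rcons v _.
have sv : size v = size P by exact: size_slp_values.
have wE i : (i < size P)%N -> w`_i = v`_i by rewrite nth_rcons sv => ->.
have wfk : slp_instr_wf k (nth SVar (rcons P o) k) by apply: wf; rewrite size_rcons ltnS.
have -> : w`_k = slp_value v (nth SVar (rcons P o) k).
  rewrite !nth_rcons sv; case: ltngtP kP => // kP _.
  apply: IH => // k' k'P; have := wf k'; rewrite size_rcons nth_rcons k'P.
  by apply; exact: ltnW.
move: wfk; case: (nth _ _ _) => //= i j /andP[ik jk];
  by rewrite !wE // (leq_trans _ kP).
Qed.

(** One multiplication at most doubles the degree reached so far. This bounds the exponents, hence
    the number of bits that [find_digit] has to try. *)
Lemma size_slp_value P k :
  (forall k, (k < size P)%N -> slp_instr_wf k (nth SVar P k)) -> (k < size P)%N ->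
  (size ((slp_values P)`_k)%R <= (2 ^ k).+1)%N.
Proof.
move=> wf; elim/ltn_ind: k => k IH kP.
have pos : (0 < 2 ^ k)%N by rewrite expn_gt0.
have IH' i : (i < k)%N -> (size ((slp_values P)`_i)%R <= (2 ^ k).+1)%N.
  by move=> ik; apply: leq_trans (IH i ik (ltn_trans ik kP)) _; rewrite ltnS leq_exp2l // ltnW.
have := wf k kP; rewrite slp_valuesE //.
case: (nth _ _ _) => [c|| i j| i j| i j] /=.
- by rewrite size_polyC; case: (_ == _).
- by rewrite size_polyX.
- by case/andP=> ik jk; rewrite (leq_trans (size_polyD _ _)) // geq_max !IH'.
- by case/andP=> ik jk; rewrite (leq_trans (size_polyD _ _)) // geq_max size_polyN !IH'.
case/andP=> ik jk; apply: leq_trans (size_polyMleq _ _) _.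
have h a : (a < k)%N -> (2 ^ a <= 2 ^ k.-1)%N by move=> ak; rewrite leq_exp2l //; lia.
have E : (2 ^ k = 2 ^ k.-1 + 2 ^ k.-1)%N.
  by rewrite addnn -mul2n -expnS prednK //; exact: leq_ltn_trans ik.
have := leq_trans (IH i ik (ltn_trans ik kP)) (h i ik : 2 ^ i < (2 ^ k.-1).+1)%N.
have := leq_trans (IH j jk (ltn_trans jk kP)) (h j jk : 2 ^ j < (2 ^ k.-1).+1)%N.
rewrite E; move: (2 ^ k.-1)%N (size _) (size _) => u v w; lia.
Qed.

End Values.

(** * The machine program *)

Local Notation nOp := 1%N.
Local Notation nArg1 := 2%N.
Local Notation nArg2 := 3%N.
Local Notation nLen := 4%N.
Local Notation nTerms := 5%N.
Local Notation nWidth := 6%N.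
Local Notation nPoints := 7%N.
Local Notation nBits := 8%N.
Local Notation nK := 9%N.
Local Notation nJ := 10%N.
Local Notation nI := 11%N.
Local Notation nBase := 12%N.
Local Notation nShift := 13%N.
Local Notation nOther := 14%N.
Local Notation nPivot := 15%N.
Local Notation nRank := 16%N.
Local Notation nLast := 17%N.
Local Notation nPow := 18%N.
Local Notation nExp := 19%N.
Local Notation sVal := 1%N.
Local Notation sPoint := 2%N.
Local Notation sSeq := 3%N.
Local Notation sRow := 4%N.
Local Notation sDiag := 5%N.
Local Notation sAcc := 6%N.
Local Notation sRatio := 7%N.
Local Notation sPow := 8%N.
Local Notation sSum := 9%N.
Local Notation sCur := 10%N.
Local Notation sRoot := 11%N.
Local Notation sQuo := 12%N.
Local Notation sNum := 13%N.
Local Notation sDen := 14%N.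
Local Notation lit0 := (NLit 0).
Local Notation lit1 := (NLit 1).
Local Notation scell a := (SGet a (NLit 0)).
Local Notation "c1 ;; c2" := (PSeq c1 c2) (at level 60, right associativity).

Definition eval_instr : prog :=
  let k := cell nK in
  let x := SGet sVal (NGet nArg1 k) in
  let y := SGet sVal (NGet nArg2 k) in
  let op := NGet nOp k in
  PIf (NEq op lit0) (PS sVal k (SGet 0 k))
  (PIf (NEq op lit1) (PS sVal k (scell sPoint))
  (PIf (NEq op (NLit 2)) (PS sVal k (SPlus x y))
  (PIf (NEq op (NLit 3)) (PS sVal k (SMinus x y))
  (PS sVal k (STimes x y))))).

Definition eval_slp : prog := PFor nK nLen eval_instr.

Definition eval_points : prog :=
  PS sPoint lit0 SOne ;;
  PFor nJ nPoints
    (eval_slp ;;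
     PS sSeq (cell nJ) (SGet sVal (NSub (cell nLen) lit1)) ;;
     PS sPoint lit0 (SPlus (scell sPoint) (scell sPoint))).

(** Evaluates functional number [nShift] on the polynomial stored at [nBase]; the Hankel entries are
    read directly from the sequence. *)
Definition inner_product : prog :=
  PS sAcc lit0 SZero ;;
  PFor nI nWidth
    (PS sAcc lit0 (SPlus (scell sAcc)
       (STimes (SGet sRow (NAdd (cell nBase) (cell nI)))
               (SGet sSeq (NAdd (cell nShift) (cell nI)))))).

Definition subtract_row : prog :=
  PFor nI nWidth
    (PS sRow (NAdd (cell nBase) (cell nI))
      (SMinus (SGet sRow (NAdd (cell nBase) (cell nI)))
        (STimes (scell sRatio) (SGet sRow (NAdd (cell nOther) (cell nI)))))).

(** The loop bound must be one of the fixed arrays, so all j < t are visited and the test keeps the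
    rows before the current one. Where row j has no pivot, the quotient by 0 is 0 and nothing is
    subtracted. *)
Definition reduce_row : prog :=
  PN nOther lit0 lit0 ;;
  PFor nJ nTerms
    (PIf (NLe (NAdd (cell nJ) lit1) (cell nK))
       (PN nShift lit0 (NGet nPivot (cell nJ)) ;;
        inner_product ;;
        PS sRatio lit0 (SDiv (scell sAcc) (SGet sDiag (cell nJ))) ;;
        subtract_row)
       PSkip ;;
     PN nOther lit0 (NAdd (cell nOther) (cell nWidth))).

(** The scan does not stop early: the pivot is the last functional that does not vanish on the row,
    and a diagonal entry 0 records that all of them vanish. *)
Definition find_pivot : prog :=
  PS sDiag (cell nK) SZero ;;
  PFor nJ nTerms
    (PN nShift lit0 (cell nJ) ;;
     inner_product ;;
     PIf (SEq (scell sAcc) SZero) PSkip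
       (PN nPivot (cell nK) (cell nJ) ;; PS sDiag (cell nK) (scell sAcc))).

(** Memory starts at 0, so writing a single 1 makes row k the monomial X^k. Naturals cannot be
    multiplied, hence row addresses are accumulated by adding the width. *)
Definition eliminate : prog :=
  PN nBase lit0 lit0 ;;
  PFor nK nWidth
    (PS sRow (NAdd (cell nBase) (cell nK)) SOne ;;
     reduce_row ;;
     find_pivot ;;
     PN nBase lit0 (NAdd (cell nBase) (cell nWidth))).

Definition find_rank : prog :=
  PN nRank lit0 lit0 ;;
  PN nLast lit0 lit0 ;;
  PFor nK nTerms
    (PIf (SEq (SGet sDiag (cell nRank)) SZero) PSkip
       (PN nRank lit0 (NAdd (cell nRank) lit1) ;;
        PN nLast lit0 (NAdd (cell nLast) (cell nWidth)))).

Definition powers : prog :=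
  PS sPow lit0 (SPlus SOne SOne) ;;
  PN nPow lit0 lit1 ;;
  PFor nK nLen
    (PS sPow (NAdd (cell nK) lit1)
       (STimes (SGet sPow (cell nK)) (SGet sPow (cell nK))) ;;
     PN nPow (NAdd (cell nK) lit1)
       (NAdd (NGet nPow (cell nK)) (NGet nPow (cell nK)))).

(** Binary search for the largest power of two not above [sSum]: the bits of its exponent are tried
    from number L down to 0, and accepting bit b multiplies [sCur] by 2^(2^b). *)
Definition find_digit : prog :=
  let b := NSub (cell nLen) (cell nK) in
  let x := STimes (scell sCur) (SGet sPow b) in
  PS sCur lit0 SOne ;;
  PN nExp lit0 lit0 ;;
  PFor nK nBits
    (PIf (SLe x (scell sSum))
       (PS sCur lit0 x ;; PN nExp lit0 (NAdd (cell nExp) (NGet nPow b)))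
       PSkip).

(** The loop makes t rounds whatever the rank; entries past the rank are meaningless, and the output
    is cut off before them. *)
Definition find_exponents : prog :=
  PS sSum lit0
    (SMinus SZero (SGet sRow (NSub (NAdd (cell nLast) (cell nRank)) lit1))) ;;
  PFor nJ nTerms
    (find_digit ;;
     PN 1 (cell nJ) (cell nExp) ;;
     PS sRoot (cell nJ) (scell sCur) ;;
     PS sSum lit0 (SMinus (scell sSum) (scell sCur))).

(** A single pass from degree t downwards: each quotient coefficient produced by synthetic division
    is used at once in the numerator and in Horner's rule for the denominator. *)
Definition find_coefficient : prog :=
  PS sQuo lit0 SZero ;;
  PS sNum lit0 SZero ;;
  PS sDen lit0 SZero ;;
  PFor nK nTerms
    (PS sQuo lit0 (SPlus (SGet sRow (NAdd (cell nLast) (NSub (cell nTerms) (cell nK))))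
       (STimes (SGet sRoot (cell nJ)) (scell sQuo))) ;;
     PS sNum lit0 (SPlus (scell sNum) (STimes (scell sQuo)
       (SGet sSeq (NSub (NSub (cell nTerms) (cell nK)) lit1)))) ;;
     PS sDen lit0 (SPlus (STimes (scell sDen) (SGet sRoot (cell nJ))) (scell sQuo))).

Definition find_coefficients : prog :=
  PFor nJ nTerms
    (find_coefficient ;; PS 0 (cell nJ) (SDiv (scell sNum) (scell sDen))).

(** Kept apart from [main] because it writes the arrays that must stay constant there. It has no
    loop, so its cost is a constant. *)
Definition bounds : prog :=
  PN nLen lit0 (cell 0) ;;
  PN nTerms lit0 (NGet 0 lit1) ;;
  PN nWidth lit0 (NAdd (NGet 0 lit1) lit1) ;;
  PN nPoints lit0 (NAdd (NGet 0 lit1) (NGet 0 lit1)) ;;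
  PN nBits lit0 (NAdd (cell 0) lit1).

(** Exponents and coefficients overwrite the operation codes and constants of the input, which is
    safe once all evaluations are done. *)
Definition main : prog :=
  eval_points ;; eliminate ;; find_rank ;; powers ;; find_exponents ;;
  find_coefficients ;; PN 0 lit0 (cell nRank).

Definition sparse_interpolation : cmd := compile (bounds ;; main).

Definition bound_arrays : seq nat := [:: nLen; nTerms; nWidth; nPoints; nBits].

Definition bound_values (L t a : nat) : nat :=
  match a with 4 => L | 5 => t | 6 => t.+1 | 7 => t + t | _ => L.+1 end%N.

Lemma main_bounded : bounded_by bound_arrays main.
Proof. by []. Qed.

Lemma main_cost L t : (0 < t)%N -> (0 < L)%N ->
  (cost_bound (bound_values L t) main + 100 <= 3000 * (t ^ 4 * L))%N.
Proof.
move=> t0 L0.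
(* The cost is a combination of 1, t, t^2, t^3, L and tL, each at most t^4 L. The constant 3000
   exceeds the sum of the coefficients, with 100 reserved for [bounds]. *)
have h3 : (t * t * t <= t ^ 4)%N.
  by rewrite (_ : t * t * t = t ^ 3)%N ?leq_pexp2l // !expnS muln1 mulnA.
have h4 : (t ^ 4 <= t ^ 4 * L)%N by rewrite leq_pmulr.
have h5 : (L <= t ^ 4 * L)%N by rewrite leq_pmull // expn_gt0 t0.
have h6 : (t * L <= t ^ 4 * L)%N by rewrite leq_mul2r -{1}(expn1 t) leq_pexp2l ?orbT.
have h1 : (t <= t * t)%N by rewrite leq_pmulr.
have h2 : (t * t <= t * t * t)%N by rewrite leq_pmulr.
move: {h3 h4}(leq_trans h3 h4) h5 h6; move: (t ^ 4 * L)%N => X h3 h5 h6.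
cbv -[addn muln leq is_true].
lia.
Qed.

(** * Exponents from a sum of distinct powers of two *)

(** This justifies the greedy reading: what follows the largest exponent e cannot add up to another
    2^e. *)
Lemma sum_exp2_lt (es : seq nat) (e : nat) :
  path gtn e es -> (\sum_(i <- es) 2 ^ i < 2 ^ e)%N.
Proof.
elim: es e => [|e' es IH] e /=; first by rewrite big_nil expn_gt0.
case/andP=> lt_e' /IH h; rewrite big_cons.
have : (2 ^ e'.+1 <= 2 ^ e)%N by rewrite leq_exp2l.
rewrite expnS; move: (2 ^ e')%N (2 ^ e)%N (\sum_(i <- es) 2 ^ i)%N h => u v w; lia.
Qed.

Lemma exp2_bracket (n e d : nat) :
  (2 ^ e <= n -> n < 2 ^ e.+1 -> 2 ^ d <= n -> n < 2 ^ d.+1 -> e = d)%N.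
Proof.
move=> e1 e2 d1 d2; apply/eqP; rewrite eqn_leq -(ltnS e) -(ltnS d).
by rewrite -(@ltn_exp2l 2 e) // -(@ltn_exp2l 2 d) // (leq_ltn_trans e1 d2) (leq_ltn_trans d1 e2).
Qed.

(** * Prony's method *)

Section Prony.
Variables (F : numFieldType) (f : {poly F}) (t : nat).

(** Decreasing, to match the order in which the greedy reading finds the exponents. *)
Definition support : seq nat := rev [seq e <- iota 0 (size f) | f`_e != 0].

Definition node (e : nat) : F := (2 ^ e)%:R.

(** The Prony polynomial, known in coding theory as the error locator. *)
Definition locator : {poly F} := \prod_(e <- support) ('X - (node e)%:P).

(* The functional q |-> sum_l q_l s_(i+l), where s_i = f(2^i). *)
Definition shifted (i : nat) (q : {poly F}) : F :=
  \sum_(e <- support) f`_e * node e ^+ i * q.[node e].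

Hypothesis f_nomial : nomial t f.

Lemma node_inj : injective node.
Proof. by move=> a b /eqP; rewrite /node eqr_nat eqn_exp2l // => /eqP. Qed.

Lemma support_sorted : sorted gtn support.
Proof.
rewrite /support rev_sorted; apply: sorted_filter; last exact: iota_ltn_sorted.
exact: ltn_trans.
Qed.

Lemma support_uniq : uniq support.
Proof. by rewrite rev_uniq filter_uniq // iota_uniq. Qed.

Lemma mem_support e : (e \in support) = (f`_e != 0).
Proof.
rewrite mem_rev mem_filter mem_iota add0n leq0n /=.
by case: ltnP => [_|h]; rewrite ?andbT // nth_default ?eqxx.
Qed.

Lemma size_support : (size support <= t)%N.
Proof.
apply: leq_trans f_nomial; rewrite size_rev size_filter -[X in (_ <= count _ X)%N](mkseq_nth 0) /mkseq count_map.
exact: leqnn.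
Qed.

Lemma sum_support (V : nmodType) (g : nat -> V) :
  (forall e, f`_e = 0 -> g e = 0) ->
  \sum_(e < size f) g e = \sum_(e <- support) g e.
Proof.
move=> g0; rewrite (perm_big _ (permEl (perm_rev _))) big_filter /=.
rewrite -(big_mkord xpredT g) /index_iota subn0 [RHS]big_mkcond /=.
by apply: eq_bigr => e _; case: eqP => // /g0.
Qed.

Lemma expansion_support : monomial_expansion [seq (f`_e, e) | e <- support] f.
Proof.
split.
- by rewrite /unzip2 -map_comp map_id support_uniq.
- by apply/allP => _ /mapP[e es ->] /=; rewrite -mem_support.
rewrite big_map /= -[LHS]coefK poly_def.
rewrite (sum_support (g := fun e => f`_e *: 'X^e)) // => e ->.
by rewrite scale0r.
Qed.

(** Since (2^i)^e = (2^e)^i, the values of [f] at powers of two are weighted power sums of the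
    nodes. The free length [n] accommodates rows padded with zeros. *)
Lemma shifted_coef i (q : {poly F}) n : (size q <= n)%N ->
  shifted i q = \sum_(l < n) q`_l * f.[2%:R ^+ (i + l)].
Proof.
move=> qn; under [RHS]eq_bigr => l _.
  rewrite horner_coef (sum_support (g := fun e => f`_e * _ ^+ e)); last first.
    by move=> e ->; rewrite mul0r.
  rewrite mulr_sumr; over.
rewrite exchange_big /=; apply: eq_bigr => e _.
rewrite (horner_coef_wide _ qn) mulr_sumr; apply: eq_bigr => l _.
have -> : (2%:R ^+ (i + l)) ^+ e = node e ^+ i * node e ^+ l.
  by rewrite /node natrX -exprD -!exprM mulnC.
ring.
Qed.

Lemma shiftedB i : {morph shifted i : p q / p - q}.
Proof.
move=> p q; rewrite /shifted -sumrB; apply: eq_bigr => e _.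
by rewrite hornerD hornerN mulrBr.
Qed.

Lemma shiftedZ i c q : shifted i (c *: q) = c * shifted i q.
Proof. by rewrite /shifted mulr_sumr; apply: eq_bigr => e _; rewrite hornerZ mulrCA. Qed.

Lemma shifted_sum i (I : Type) (r : seq I) (P : pred I) (g : I -> {poly F}) :
  shifted i (\sum_(k <- r | P k) g k) = \sum_(k <- r | P k) shifted i (g k).
Proof.
rewrite /shifted exchange_big /=; apply: eq_bigr => e _.
by rewrite horner_sum mulr_sumr.
Qed.

Lemma locator_monic : locator \is monic.
Proof. exact: monic_prod_XsubC. Qed.

Lemma size_locator : size locator = (size support).+1.
Proof. exact: size_prod_XsubC. Qed.

Lemma root_locator e : e \in support -> locator.[node e] = 0.
Proof.
by move=> es; rewrite /locator horner_prod (big_rem e) //= hornerXsubC subrr mul0r.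
Qed.

Lemma shifted_locator i : shifted i locator = 0.
Proof.
rewrite /shifted big_seq big1 // => e es; by rewrite root_locator // mulr0.
Qed.

(** The weights node^i with i < t span all weights g(node) with g of degree below t. *)
Lemma shifted_comb (g q : {poly F}) : (size g <= t)%N ->
  (forall i, (i < t)%N -> shifted i q = 0) ->
  \sum_(e <- support) f`_e * g.[node e] * q.[node e] = 0.
Proof.
move=> gt h; transitivity (\sum_(i < t) g`_i * shifted i q); last first.
  by rewrite big1 // => i _; rewrite h ?mulr0.
rewrite /shifted; under [RHS]eq_bigr => i _ do rewrite mulr_sumr.
rewrite exchange_big /=; apply: eq_bigr => e _.
rewrite (horner_coef_wide _ gt) mulr_sumr mulr_suml; apply: eq_bigr => i _.
ring.
Qed.

(** Up to a scalar, the Lagrange polynomial of the node of [e] among the nodes of the support. *)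
Definition cofactor (e : nat) : {poly F} :=
  \prod_(d <- rem e support) ('X - (node d)%:P).

Lemma locator_cofactor e : e \in support ->
  locator = ('X - (node e)%:P) * cofactor e.
Proof. by move=> es; rewrite /locator (big_rem e). Qed.

Lemma cofactor_neq0 e : (cofactor e).[node e] != 0.
Proof.
rewrite horner_prod prodf_seq_neq0; apply/allP => d; rewrite mem_rem_uniq ?support_uniq //.
rewrite inE => /andP[de _].
by rewrite hornerXsubC subr_eq0 (inj_eq node_inj) eq_sym.
Qed.

Lemma cofactor_eq0 e d : d \in support -> d != e -> (cofactor e).[node d] = 0.
Proof.
move=> ds de; rewrite horner_prod (big_rem d) /=; last by rewrite mem_rem_uniq ?support_uniq // inE de.
by rewrite hornerXsubC subrr mul0r.
Qed.

Lemma sum_cofactor e (q : {poly F}) : e \in support ->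
  \sum_(d <- support) f`_d * (cofactor e).[node d] * q.[node d] =
  f`_e * (cofactor e).[node e] * q.[node e].
Proof.
move=> es; rewrite (big_rem e) //= [X in _ + X]big_seq big1 ?addr0 // => d.
rewrite mem_rem_uniq ?support_uniq // inE => /andP[de ds].
by rewrite cofactor_eq0 // mulr0 mul0r.
Qed.

(** Weighting by the Lagrange polynomial isolates one node. Its degree is below t because the
    support has at most t elements. *)
Lemma shifted_eq0 q e : (forall i, (i < t)%N -> shifted i q = 0) ->
  e \in support -> q.[node e] = 0.
Proof.
move=> h es.
have sg : (size (cofactor e) <= t)%N.
  rewrite size_prod_XsubC size_rem // prednK ?size_support //.
  by case: support es.
have := shifted_comb sg h; rewrite sum_cofactor // => /eqP.
rewrite !mulf_eq0 (negPf (cofactor_neq0 e)) orbF => /orP[|/eqP //].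
by move: es; rewrite mem_support => /negPf ->.
Qed.

(* Row k of the elimination is p k, and d k is its value at its pivot functional,
   which is number v k. *)
Definition echelon (p : nat -> {poly F}) (d : nat -> F) (v : nat -> nat) : Prop :=
  forall k, (k <= t)%N ->
  [/\ p k \is monic, size (p k) = k.+1,
      d k = 0 -> forall i, (i < t)%N -> shifted i (p k) = 0,
      d k != 0 -> shifted (v k) (p k) = d k
    & forall j, (j < k)%N -> d j != 0 -> shifted (v j) (p k) = 0].

Section Echelon.
Variables (p : nat -> {poly F}) (d : nat -> F) (v : nat -> nat).
Hypothesis ech : echelon p d v.

(** Otherwise row k, of degree k, would have every node as a root, which is too many. *)
Lemma echelon_diag k : (k < size support)%N -> d k != 0.
Proof.
move=> ks; have [pm ps h _ _] := ech (ltnW (leq_trans ks size_support)).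
apply/eqP => d0; have /negP[] := monic_neq0 pm.
apply: contraTT ks => p0; rewrite -leqNgt -ltnS -ps.
rewrite -(size_map node); apply: max_poly_roots => //.
  apply/allP => _ /mapP[e es ->]; apply/rootP; apply: shifted_eq0 es.
  exact: h.
by rewrite map_inj_uniq ?support_uniq //; exact: node_inj.
Qed.

Lemma echelon_span n (g : {poly F}) : (n <= t)%N -> (size g <= n)%N ->
  exists a : nat -> F, g = \sum_(k < n) a k *: p k.
Proof.
elim: n g => [|n IH] g nt.
  by rewrite leqn0 size_poly_eq0 => /eqP ->; exists (fun=> 0); rewrite big_ord0.
move=> gn; have [pm ps _ _ _] := ech (ltnW nt).
have [|a ga] := IH (g - g`_n *: p n) (ltnW nt).
  apply/leq_sizeP => j nj; rewrite coefB coefZ.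
  have := nj; rewrite leq_eqVlt => /predU1P[<-|nj'].
    by move/monicP: pm; rewrite /lead_coef ps /= => ->; rewrite mulr1 subrr.
  rewrite (nth_default _ (leq_trans gn nj')) (@nth_default _ _ (p n)) ?ps //.
  by rewrite mulr0 subrr.
exists (fun k => if k == n then g`_n else a k).
rewrite big_ord_recr /= eqxx -[LHS](subrK (g`_n *: p n)) ga; congr (_ + _).
by apply: eq_bigr => k _; rewrite ltn_eqF.
Qed.

(** The difference of two monic polynomials of degree m is a combination of the rows before m. All
    their pivot functionals kill it, and this triangular system has a nonzero diagonal, so the
    combination is zero. *)
Lemma echelon_locator : p (size support) = locator.
Proof.
set m := size support; have [pm ps h _ orth] := ech size_support.
have [|a ga] := @echelon_span m (locator - p m) size_support.
  apply/leq_sizeP => j mj; rewrite coefB.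
  have := mj; rewrite leq_eqVlt => /predU1P[<-|mj'].
    move/monicP: pm; move/monicP: locator_monic.
    by rewrite /lead_coef ps size_locator /= => -> ->; rewrite subrr.
  by rewrite !nth_default ?subrr // ?size_locator ?ps.
have a0 j : (j < m)%N -> a j = 0.
  elim/ltn_ind: j => j IH jm; have dj := echelon_diag jm.
  have jt := ltnW (leq_trans jm size_support).
  have := shiftedB (v j) locator (p m).
  rewrite shifted_locator orth // subr0 ga shifted_sum (bigD1 (Ordinal jm)) //= big1.
    rewrite addr0 shiftedZ; have [_ _ _ -> // _] := ech jt.
    by move/eqP; rewrite mulf_eq0 (negPf dj) orbF => /eqP.
  move=> k; rewrite -val_eqE neq_ltn shiftedZ /= => /orP[kj|jk].
    by rewrite IH // mul0r.
  by have [_ _ _ _ -> //] := ech (ltnW (leq_trans (ltn_ord k) size_support)); rewrite mulr0.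
apply/esym/eqP; rewrite -subr_eq0 ga big1 // => k _.
by rewrite a0 // scale0r.
Qed.

End Echelon.

Lemma locator_sum : (0 < size support)%N ->
  - locator`_(size support).-1 = (\sum_(e <- support) 2 ^ e)%:R.
Proof.
move=> m0; rewrite /locator -(big_map node xpredT (fun x => 'X - x%:P)) -(size_map node).
by rewrite coefPn_prod_XsubC ?size_map -?lt0n // opprK big_map natr_sum.
Qed.

(* Synthetic division of the locator by 'X - r, with t - size support leading
   zero coefficients. *)
Fixpoint horner_quo (r : F) (k : nat) : F :=
  if k is k'.+1 then locator`_(t - k') + r * horner_quo r k' else 0.

(** The recurrence matches all coefficients of positive degree, so [locator] and ('X - r) q differ
    by a constant; evaluating at the root r shows that it is 0. *)
Lemma horner_quo_cofactor e : e \in support ->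
  \poly_(i < t) horner_quo (node e) (t - i) = cofactor e.
Proof.
move=> es; set q := poly _ _; set r := node e.
have qE i : q`_i = horner_quo r (t - i).
  rewrite coef_poly; case: ltnP => // ti.
  by rewrite (eqP (ti : (t - i == 0)%N)).
suff E : locator = ('X - r%:P) * q.
  have nz : 'X - r%:P != 0 by rewrite polyXsubC_eq0.
  by apply: (mulfI nz); rewrite -E -locator_cofactor.
have dif : locator - ('X - r%:P) * q = (locator`_0 + r * q`_0)%:P.
  apply/polyP => i; rewrite coefB mulrBl coefB coefXM coefCM coefC.
  case: i => [|i] /=; first by rewrite sub0r opprK.
  rewrite !qE; case: (ltnP i t) => [it|ti].
    rewrite (_ : t - i = (t - i.+1).+1)%N /=; last by lia.
    by rewrite (_ : t - (t - i.+1) = i.+1)%N; [ring | lia].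
  rewrite nth_default ?size_locator; last by rewrite ltnS (leq_trans size_support).
  have -> : (t - i = 0)%N by apply/eqP.
  have -> : (t - i.+1 = 0)%N by apply/eqP; exact: leqW.
  by rewrite /= mulr0 !subrr.
have := congr1 (horner^~ r) dif.
rewrite hornerD hornerN hornerM hornerXsubC subrr mul0r subr0 hornerC root_locator //.
by move=> c0; apply/eqP; rewrite -subr_eq0 dif -c0.
Qed.

(** The numerator is the sum of the f_d q(2^d) over the support, and q vanishes at every node but
    that of [e]. *)
Lemma quotient_coef e : e \in support ->
  (\sum_(i < t) horner_quo (node e) (t - i) * f.[2%:R ^+ i]) /
  (\sum_(i < t) horner_quo (node e) (t - i) * node e ^+ i) = f`_e.
Proof.
move=> es; have := horner_quo_cofactor es; set q := poly _ _ => qE.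
have sq : (size q <= t)%N by exact: size_poly.
have -> : \sum_(i < t) horner_quo (node e) (t - i) * node e ^+ i = q.[node e].
  rewrite (horner_coef_wide _ sq); apply: eq_bigr => i _.
  by rewrite coef_poly ltn_ord.
have -> : \sum_(i < t) horner_quo (node e) (t - i) * f.[2%:R ^+ i] = shifted 0 q.
  rewrite (shifted_coef _ sq); apply: eq_bigr => i _.
  by rewrite coef_poly ltn_ord.
have <- : \sum_(d <- support) f`_d * q.[node d] * 1%:P.[node d] = shifted 0 q.
  by apply: eq_bigr => d _; rewrite hornerC expr0 !mulr1.
by rewrite qE sum_cofactor // hornerC mulr1 mulfK // cofactor_neq0.
Qed.

End Prony.

(** * What the blocks of the program compute *)

(* Matching keeps the rewriting syntactic; up to conversion, every state is an
   update of itself. *)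
Ltac mem :=
  repeat (rewrite ?eqxx /=;
  repeat match goal with
  | |- context [sem (PSeq ?c1 ?c2) ?s] => rewrite (sem_seq c1 c2 s)
  | |- context [sem (PN ?a ?i ?e) ?s] => rewrite (sem_n a i e s)
  | |- context [sem (PS ?a ?i ?e) ?s] => rewrite (sem_s a i e s)
  | |- context [sem (PIf ?b ?c1 ?c2) ?s] => rewrite (sem_if b c1 c2 s)
  | |- context [sem PSkip ?s] => rewrite (sem_skip s)
  | |- context [nmem (setn ?s ?a ?i ?x) ?b ?j] => rewrite (nmem_setn s a i x b j)
  | |- context [smem (setn ?s ?a ?i ?x) ?b ?j] => rewrite (smem_setn s a i x b j)
  | |- context [nmem (sets ?s ?a ?i ?x) ?b ?j] => rewrite (nmem_sets s a i x b j)
  | |- context [smem (sets ?s ?a ?i ?x) ?b ?j] => rewrite (smem_sets s a i x b j)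
  | |- context [nmem (sem ?c ?s) ?a ?i] => rewrite (@nmem_frame _ c s a i isT)
  | |- context [smem (sem ?c ?s) ?a ?i] => rewrite (@smem_frame _ c s a i isT)
  | h : forall a i, is_true (a \notin _) -> nmem ?r a i = _ |- context [nmem ?r ?a ?i] =>
      rewrite (h a i isT)
  | h : forall a i, is_true (a \notin _) -> smem ?r a i = _ |- context [smem ?r ?a ?i] =>
      rewrite (h a i isT)
  end).

Definition dot (F : numFieldType) (w : nat) (sq row : nat -> F) (b i : nat) : F :=
  \sum_(l < w) row (b + l)%N * sq (i + l)%N.

Lemma eq_dot (F : numFieldType) (w : nat) (sq sq' row row' : nat -> F) (b i : nat) :
  (forall l, (l < w)%N -> row (b + l)%N = row' (b + l)%N) -> sq =1 sq' ->
  dot w sq row b i = dot w sq' row' b i.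
Proof. by move=> h h'; apply: eq_bigr => l _; rewrite h // h'. Qed.

Section Rows.
Variables (F : numFieldType) (w t : nat).
Implicit Types sq row d : nat -> F.

Lemma dot_sub sq row row' (b o : nat) (c : F) i :
  (forall l, (l < w)%N -> row' (b + l)%N = row (b + l)%N - c * row (o + l)%N) ->
  dot w sq row' b i = dot w sq row b i - c * dot w sq row o i.
Proof.
move=> h; rewrite /dot mulr_sumr -sumrB; apply: eq_bigr => l _.
by rewrite h // mulrBl mulrA.
Qed.

(* Row j of width w starts at address j * w; d j and v j are its pivot value
   and the number of its pivot functional. *)
Definition rows_reduced (sq row d : nat -> F) (v : nat -> nat) (k : nat) : Prop :=
  forall j, (j < k)%N ->
  [/\ row (j * w + j)%N = 1,
      forall l, (j < l < w)%N -> row (j * w + l)%N = 0,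
      d j = 0 -> forall i, (i < t)%N -> dot w sq row (j * w) i = 0,
      d j != 0 -> (v j < t)%N /\ dot w sq row (j * w) (v j) = d j
    & forall j', (j' < j)%N -> d j' != 0 -> dot w sq row (j * w) (v j') = 0].

(** Rows before [k] live at addresses below [k * w], so work on row k leaves their invariant
    intact. *)
Lemma eq_rows_reduced sq sq' row row' d d' v v' k :
  (k <= w)%N -> sq =1 sq' ->
  (forall a, (a < k * w)%N -> row a = row' a) ->
  (forall j, (j < k)%N -> d j = d' j) -> (forall j, (j < k)%N -> v j = v' j) ->
  rows_reduced sq row d v k -> rows_reduced sq' row' d' v' k.
Proof.
move=> kw esq er ed ev h j jk; have [h1 h2 h3 h4 h5] := h j jk.
have jw l : (l < w)%N -> (j * w + l < k * w)%N.
  by move=> lw; apply: leq_trans (_ : j.+1 * w <= _)%N; rewrite ?leq_mul2r ?jk ?orbT // mulSn; lia.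
have edot i : dot w sq' row' (j * w) i = dot w sq row (j * w) i.
  by apply: eq_dot => [l lw|l]; rewrite ?esq // er // jw.
split.
- by rewrite -er ?jw ?h1 // (leq_trans jk).
- by move=> l /andP[jl lw]; rewrite -er ?jw ?h2 // jl.
- by rewrite -ed // => d0 i it; rewrite edot h3.
- by rewrite -ed // -ev // edot; exact: h4.
- move=> j' j'j; have j'k := ltn_trans j'j jk.
  by rewrite -ed // -ev // edot; exact: h5.
Qed.

End Rows.

Section Blocks.
Variable F : numFieldType.
Implicit Types s r : state F.

(** * Elimination and rank *)

Lemma inner_productE s :
  smem (sem inner_product s) sAcc 0 =
  dot (nmem s nWidth 0) (smem s sSeq) (smem s sRow) (nmem s nBase 0) (nmem s nShift 0).
Proof.
pose I k r := smem r sAcc 0 = dot k (smem s sSeq) (smem s sRow) (nmem s nBase 0) (nmem s nShift 0).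
rewrite /inner_product sem_seq; apply: (for_ind (I := I)); [by [] | by [] | |].
  by rewrite /I /dot big_ord0; mem.
move=> k r _ rk hN hS; rewrite /I => IH; mem.
by rewrite /dot big_ord_recr IH rk; mem.
Qed.

(** The update is in place; [nOther] plus the width not exceeding [nBase] ensures that the entries
    read from the other row are still the old ones. *)
Lemma subtract_rowE s a :
  (nmem s nOther 0 + nmem s nWidth 0 <= nmem s nBase 0)%N ->
  smem (sem subtract_row s) sRow a =
  if (nmem s nBase 0 <= a < nmem s nBase 0 + nmem s nWidth 0)%N then
    smem s sRow a - smem s sRatio 0 * smem s sRow (nmem s nOther 0 + (a - nmem s nBase 0))
  else smem s sRow a.
Proof.
set b := nmem s nBase 0; set o := nmem s nOther 0; set w := nmem s nWidth 0.
move=> sep.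
pose I k r := forall a, smem r sRow a = if (b <= a < b + k)%N then
    smem s sRow a - smem s sRatio 0 * smem s sRow (o + (a - b)) else smem s sRow a.
move: a; apply: (for_ind (I := I)); [by [] | by [] | |].
  by move=> a'; mem; case: ifP => //; lia.
move=> k r kw rk hN hS IH a'; mem; rewrite rk -/b -/o !IH.
have [->|ne] := eqVneq a' (b + k)%N.
  have -> : (b <= b + k < b + k)%N = false by lia.
  have -> : (b <= o + k < b + k)%N = false by lia.
  have -> : (b <= b + k < b + k.+1)%N = true by lia.
  by rewrite addKn.
by congr (if _ then _ else _); lia.
Qed.

(** Gram-Schmidt against the pivots: subtracting [c] times row j kills pivot functional j and spoils
    none before it, as row j already vanishes there. Row j is zero beyond position j < k, so the
    leading 1 and the zeros after it survive. *)
Lemma reduce_rowP s k :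
  let w := nmem s nWidth 0 in let sq := smem s sSeq in
  let d := smem s sDiag in let v := nmem s nPivot in
  let s' := sem reduce_row s in
  nmem s nK 0 = k -> nmem s nBase 0 = (k * w)%N -> (k < w)%N -> (k <= nmem s nTerms 0)%N ->
  rows_reduced w (nmem s nTerms 0) sq (smem s sRow) d v k ->
  smem s sRow (k * w + k) = 1 ->
  (forall l, (k < l < w)%N -> smem s sRow (k * w + l) = 0) ->
  [/\ forall a, ~~ (k * w <= a < k * w + w)%N -> smem s' sRow a = smem s sRow a,
      smem s' sRow (k * w + k) = 1,
      forall l, (k < l < w)%N -> smem s' sRow (k * w + l) = 0
    & forall j, (j < k)%N -> d j != 0 -> dot w sq (smem s' sRow) (k * w) (v j) = 0].
Proof.
move=> w sq d v s' sk sb kw kt red row1 row0.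
pose I j r := [/\ nmem r nOther 0 = (j * w)%N,
  forall a, ~~ (k * w <= a < k * w + w)%N -> smem r sRow a = smem s sRow a,
  smem r sRow (k * w + k) = 1,
  forall l, (k < l < w)%N -> smem r sRow (k * w + l) = 0
  & forall j', (j' < j)%N -> (j' < k)%N -> d j' != 0 ->
      dot w sq (smem r sRow) (k * w) (v j') = 0].
suff [_ h1 h2 h3 h4] : I (nmem s nTerms 0) s'.
  by split=> // j jk; apply: h4 => //; exact: leq_trans kt.
rewrite /s' /reduce_row sem_seq; apply: (for_ind (I := I)); [by [] | by [] | |].
  by split=> // *; mem.
move=> j r jt rj hN hS [io irow i1 i0 iorth].
rewrite sem_seq sem_if /= rj; mem; rewrite sk addn1.
case: ltnP => jk; last first.
  split=> //; mem => //; first by rewrite io mulSn addnC.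
  by move=> j' j'j j'k; apply: iorth => //; lia.
set r1 := sem subtract_row _.
pose c := dot w sq (smem r sRow) (k * w) (v j) / d j.
have sep : (j * w + w <= k * w)%N by rewrite addnC -mulSn leq_mul2r jk orbT.
have row_r1 a : smem r1 sRow a = if (k * w <= a < k * w + w)%N then
    smem r sRow a - c * smem r sRow (j * w + (a - k * w)) else smem r sRow a.
  rewrite /r1 subtract_rowE; mem; rewrite ?sb ?io //.
  rewrite inner_productE; mem; rewrite sb rj; congr (if _ then _ - _ / _ * _ else _).
  by apply: eq_dot => [l _|l]; mem.
have row_sub l : (l < w)%N ->
    smem r1 sRow (k * w + l) = smem r sRow (k * w + l) - c * smem r sRow (j * w + l).
  by move=> lw; rewrite row_r1 leq_addr ltn_add2l lw addKn.
have [_ j0 _ jd jorth] := red j jk.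
have row_j l : (l < w)%N -> smem r sRow (j * w + l) = smem s sRow (j * w + l).
  by move=> lw; apply: irow; lia.
have dot_j i : dot w sq (smem r sRow) (j * w) i = dot w sq (smem s sRow) (j * w) i.
  by apply: eq_dot => // l lw; rewrite row_j.
split.
- by mem; rewrite /r1; mem; rewrite io mulSn addnC.
- by move=> a ha; mem; rewrite row_r1 (negPf ha) irow.
- by mem; rewrite row_sub // row_j // j0 ?jk // mulr0 subr0.
- move=> l /andP[kl lw]; mem; rewrite row_sub // row_j // j0 ?(ltn_trans jk) //.
  by rewrite i0 ?kl // mulr0 subr0.
move=> j' j'j j'k dj'.
have -> : dot w sq (smem (setn (sem (PN nOther lit0 (NAdd (cell nOther) (cell nWidth))) r1) nJ 0 j.+1)
    sRow) (k * w) (v j') = dot w sq (smem r sRow) (k * w) (v j') -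
    c * dot w sq (smem r sRow) (j * w) (v j').
  by apply: dot_sub => l lw; mem; exact: row_sub.
have := j'j; rewrite ltnS leq_eqVlt => /predU1P[jj|j'j'].
  rewrite jj in dj' *; rewrite dot_j (jd dj').2 /c divfK ?subrr //.
by rewrite dot_j jorth // iorth // mulr0 subr0.
Qed.

Lemma find_pivotP s k :
  let w := nmem s nWidth 0 in let t := nmem s nTerms 0 in let sq := smem s sSeq in
  let row := smem s sRow in let b := nmem s nBase 0 in
  let s' := sem find_pivot s in
  let d := smem s' sDiag in let v := nmem s' nPivot in
  nmem s nK 0 = k ->
  [/\ forall j, j != k -> d j = smem s sDiag j,
      forall j, j != k -> v j = nmem s nPivot j,
      d k = 0 -> forall i, (i < t)%N -> dot w sq row b i = 0
    & d k != 0 -> (v k < t)%N /\ dot w sq row b (v k) = d k].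
Proof.
move=> w t sq row b s' d v sk.
pose I i r := [/\ forall j, j != k -> smem r sDiag j = smem s sDiag j,
  forall j, j != k -> nmem r nPivot j = nmem s nPivot j,
  smem r sDiag k = 0 -> forall i', (i' < i)%N -> dot w sq row b i' = 0
  & smem r sDiag k != 0 ->
      (nmem r nPivot k < t)%N /\ dot w sq row b (nmem r nPivot k) = smem r sDiag k].
suff [h1 h2 h3 h4] : I t s' by [].
rewrite /s' /find_pivot sem_seq; apply: (for_ind (I := I)); [by [] | by [] | |].
  by split=> //; [move=> j jk|]; mem; rewrite sk ?(negPf jk) // eqxx eqxx.
move=> i r it ri hN hS [h1 h2 h3 h4].
set r1 := sem _ r.
have acc : smem (sem inner_product (setn r nShift 0 (nmem r nJ 0))) sAcc 0 =
    dot w sq row b i.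
  rewrite inner_productE; mem; rewrite ri.
  by apply: eq_dot => [l _|l]; mem.
have -> : r1 = if dot w sq row b i == 0
    then sem inner_product (setn r nShift 0 (nmem r nJ 0))
    else sets (setn (sem inner_product (setn r nShift 0 (nmem r nJ 0))) nPivot k i) sDiag k
      (dot w sq row b i).
  rewrite /r1; mem.
  by rewrite acc sk ri.
case: ifPn => dot0.
  split=> [j jk|j jk||]; mem; auto.
  move=> d0 i'; rewrite ltnS leq_eqVlt => /predU1P[->|]; first exact/eqP.
  exact: h3.
split=> [j jk|j jk||]; mem; rewrite ?(negPf jk); auto.
by move=> d0; rewrite d0 eqxx in dot0.
Qed.

Lemma eliminateP s :
  let w := nmem s nWidth 0 in let t := nmem s nTerms 0 in
  let s' := sem eliminate s in
  w = t.+1 -> (forall a, smem s sRow a = 0) ->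
  rows_reduced w t (smem s sSeq) (smem s' sRow) (smem s' sDiag) (nmem s' nPivot) w.
Proof.
move=> w t s' wt row0.
pose I k r := [/\ nmem r nBase 0 = (k * w)%N,
  forall a, (k * w <= a)%N -> smem r sRow a = 0
  & rows_reduced w t (smem s sSeq) (smem r sRow) (smem r sDiag) (nmem r nPivot) k].
suff [] : I w s' by [].
rewrite /s' /eliminate sem_seq; apply: (for_ind (I := I)); [by [] | by [] | |].
  by split=> [|a _|//]; mem.
move=> k r kw rk hN hS [rb r0 red].
have e_w : nmem r nWidth 0 = w by mem.
have e_t : nmem r nTerms 0 = t by mem.
rewrite 3!sem_seq; set r1 := sem (PS _ _ _) r; set r2 := sem reduce_row r1.
set r3 := sem find_pivot r2.
have row_r1 a : smem r1 sRow a = if a == (k * w + k)%N then 1 else smem r sRow a.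
  by rewrite /r1; mem; rewrite rb rk.
have red1 : rows_reduced w t (smem r1 sSeq) (smem r1 sRow) (smem r1 sDiag) (nmem r1 nPivot) k.
  apply: eq_rows_reduced red => // [|a|a ak]; first exact: ltnW.
    by rewrite /r1; mem.
  by rewrite row_r1 ifF //; lia.
have e_w1 : nmem r1 nWidth 0 = w by rewrite /r1; mem.
have e_t1 : nmem r1 nTerms 0 = t by rewrite /r1; mem.
have [||||||l /andP[kl lw]|row2 row2k row20 orth2] := @reduce_rowP r1 k; rewrite ?e_w1 ?e_t1 //.
- by rewrite -ltnS -wt.
- by rewrite row_r1 eqxx.
- by rewrite row_r1 ifF ?r0 //; lia.
rewrite e_w1 in row2 row2k row20 orth2.
have [|d3 v3 zero3 piv3] := @find_pivotP r2 k; first by rewrite /r2 /r1; mem.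
have e_w2 : nmem r2 nWidth 0 = w by rewrite /r2; mem.
have e_t2 : nmem r2 nTerms 0 = t by rewrite /r2; mem.
have e_b2 : nmem r2 nBase 0 = (k * w)%N by rewrite /r2 /r1; mem.
rewrite e_w2 e_t2 e_b2 -/r3 in d3 v3 zero3 piv3.
have sq2 : smem r2 sSeq =1 smem s sSeq by move=> a; rewrite /r2 /r1; mem.
have sq1 : smem r1 sSeq =1 smem s sSeq by move=> a; rewrite /r1; mem.
split; first by rewrite /r3 /r2 /r1; mem; rewrite rb mulSn addnC.
  move=> a; rewrite mulSn => ka; rewrite /r3; mem; rewrite row2; last by lia.
  by rewrite row_r1 ifF ?r0 //; lia.
have low j : (j < k)%N -> smem r3 sDiag j = smem r sDiag j.
  by move=> jk; rewrite d3 ?ltn_eqF // /r2 /r1; mem.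
have lowv j : (j < k)%N -> nmem r3 nPivot j = nmem r nPivot j.
  by move=> jk; rewrite v3 ?ltn_eqF // /r2 /r1; mem.
apply: (@eq_rows_reduced _ w t (smem s sSeq) _ (smem r2 sRow) _ (smem r3 sDiag) _ (nmem r3 nPivot)) => //.
- by move=> a _; rewrite /r3; mem.
move=> j; rewrite ltnS leq_eqVlt => /predU1P[->|jk].
  split=> //.
  - by move=> d0 i it; rewrite -(zero3 d0 i it); exact: eq_dot.
  - by move=> /piv3[vt <-]; split=> //; exact: eq_dot.
  move=> i ik; rewrite low // lowv // => d0.
  rewrite -(orth2 i ik); last by rewrite /r1; mem.
  by rewrite (_ : nmem r1 _ _ = nmem r nPivot i); [exact: eq_dot | rewrite /r1; mem].
suff : rows_reduced w t (smem s sSeq) (smem r2 sRow) (smem r3 sDiag) (nmem r3 nPivot) k.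
  exact.
apply: eq_rows_reduced red => // [|a ak|i ik|i ik]; first exact: ltnW.
- by rewrite row2 ?row_r1 ?ifF //; lia.
- by rewrite low.
- by rewrite lowv.
Qed.

(** The counter stalls at the first zero diagonal entry, hence the invariant with [minn k m]. *)
Lemma find_rankP s m :
  let t := nmem s nTerms 0 in let s' := sem find_rank s in
  (m <= t)%N -> (forall j, (j < m)%N -> smem s sDiag j != 0) -> smem s sDiag m = 0 ->
  nmem s' nRank 0 = m /\ nmem s' nLast 0 = (m * nmem s nWidth 0)%N.
Proof.
move=> t s' mt dj dm.
pose I k r := nmem r nRank 0 = minn k m /\ nmem r nLast 0 = (minn k m * nmem s nWidth 0)%N.
suff : I t s' by rewrite /I (minn_idPr mt).
rewrite /s' /find_rank 2!sem_seq; apply: (for_ind (I := I)); [by [] | by [] | |].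
  by split; mem; rewrite min0n.
move=> k r kt _ hN hS [h1 h2]; mem; rewrite h1.
case: (ltnP k m) => km.
  rewrite (minn_idPl (ltnW km)) in h1 h2 *; rewrite (negPf (dj k km)).
  by split; mem; rewrite (minn_idPl km) ?h1 ?h2 ?addn1 // mulSn addnC.
rewrite (minn_idPr km) in h1 h2 *; rewrite dm eqxx.
by split; mem; rewrite (minn_idPr (leqW km)).
Qed.

(** * Powers of two and binary search *)

Lemma powersP s k :
  let s' := sem powers s in
  (k <= nmem s nLen 0)%N ->
  smem s' sPow k = (2 ^ (2 ^ k))%:R /\ nmem s' nPow k = (2 ^ k)%N.
Proof.
move=> s'.
pose I n r := forall k, (k <= n)%N -> smem r sPow k = (2 ^ (2 ^ k))%:R /\ nmem r nPow k = (2 ^ k)%N.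
suff : I (nmem s nLen 0) s' by apply.
rewrite /s' /powers 2!sem_seq; apply: (for_ind (I := I)); [by [] | by [] | |].
  by case=> // _; mem.
move=> n r _ rn hN hS IH j; rewrite leq_eqVlt => /predU1P[->|jn]; mem; rewrite rn addn1.
  have [p1 p2] := IH n (leqnn n).
  by rewrite eqxx p1 p2 -natrM -expnD addnn -mul2n -expnS.
rewrite ltn_eqF //; exact: IH.
Qed.

Lemma find_digitP s n e :
  let L := nmem s nLen 0 in let s' := sem find_digit s in
  nmem s nBits 0 = L.+1 ->
  (forall k, (k <= L)%N -> smem s sPow k = (2 ^ (2 ^ k))%:R /\ nmem s nPow k = (2 ^ k)%N) ->
  smem s sSum 0 = n%:R -> (2 ^ e <= n < 2 ^ e.+1)%N -> (e < 2 ^ L.+1)%N ->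
  smem s' sCur 0 = (2 ^ e)%:R /\ nmem s' nExp 0 = e.
Proof.
move=> L s' sb pow sn /andP[en ne] eL.
(* The exponent lies in a window that starts at [c] and halves each round; after L + 1 rounds it has
   length 1. *)
pose I k r := exists2 c, smem r sCur 0 = (2 ^ c)%:R /\ nmem r nExp 0 = c
  & (2 ^ c <= n < 2 ^ (c + 2 ^ (L.+1 - k)))%N.
suff [c [-> ->] /andP[cn nc]] : I L.+1 s'.
  by rewrite subnn addn1 in nc; rewrite (exp2_bracket en ne cn nc).
rewrite /s' /find_digit 2!sem_seq; apply: (for_ind (I := I)); [by [] | by rewrite -sb | |].
  exists 0%N; first by mem.
  rewrite (leq_trans _ en) ?expn_gt0 //= add0n subn0.
  by apply: leq_trans ne _; rewrite leq_exp2l.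
move=> k r kL rk hN hS [c [r1 r2] /andP[cn nc]].
have [p1 p2] := pow (L - k)%N (leq_subr _ _).
mem; rewrite rk r1 r2 sn -/L p1 p2 -natrM ler_nat -expnD.
have e2 : (2 ^ (L.+1 - k) = 2 ^ (L - k) + 2 ^ (L - k))%N.
  by rewrite subSn // expnS mul2n addnn.
rewrite e2 in nc.
case: leqP => h; last first.
  by exists c; [mem | rewrite subSS cn h].
exists (c + 2 ^ (L - k))%N; first by mem.
by rewrite subSS h /= -addnA.
Qed.

(** * Evaluation of the straight-line program *)

Definition loaded (P : slp F) (s : state F) : Prop :=
  forall k, (k < size P)%N ->
  [/\ nmem s nOp k = slp_opcode (nth SVar P k), nmem s nArg1 k = slp_arg1 (nth SVar P k),
      nmem s nArg2 k = slp_arg2 (nth SVar P k) & smem s 0 k = slp_const (nth SVar P k)].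

(** [sVal] still holds the values at the previous point, but by well-formedness every operand has
    been rewritten before it is read. *)
Lemma eval_slpP s (P : slp F) :
  (forall k, (k < size P)%N -> slp_instr_wf k (nth SVar P k)) ->
  loaded P s -> nmem s nLen 0 = size P ->
  forall k, (k < size P)%N ->
  smem (sem eval_slp s) sVal k = ((slp_values P)`_k).[smem s sPoint 0].
Proof.
move=> wf ld sL.
pose I n r := forall k, (k < n)%N -> smem r sVal k = ((slp_values P)`_k).[smem s sPoint 0].
apply: (for_ind (I := I)); [by [] | by [] | by [] |].
move=> k r kP rk hN hS IH j; rewrite ltnS => jk.
have [op a1 a2 c] := ld k kP.
have -> : sem eval_instr r = sets r sVal k ((slp_values P)`_k).[smem s sPoint 0].
  rewrite /eval_instr; mem; rewrite rk op a1 a2 c slp_valuesE //.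
  move: (wf k kP); case: (nth SVar P k) => [x||i1 i2|i1 i2|i1 i2] //=.
  - by rewrite hornerC.
  - by rewrite hornerX.
  - by case/andP=> h1 h2; rewrite hornerD !IH.
  - by case/andP=> h1 h2; rewrite hornerD hornerN !IH.
  - by case/andP=> h1 h2; rewrite hornerM !IH.
mem; case: eqVneq => [->|ne] //.
by apply: IH; rewrite ltn_neqAle ne.
Qed.

Lemma eval_pointsP s (P : slp F) f :
  slp_represents P f -> loaded P s -> nmem s nLen 0 = size P ->
  forall i, (i < nmem s nPoints 0)%N ->
  smem (sem eval_points s) sSeq i = f.[2%:R ^+ i].
Proof.
case=> /andP[P0 /allP wf'] Pf ld sL.
have wf k : (k < size P)%N -> slp_instr_wf k (nth SVar P k).
  by move=> kP; apply: wf'; rewrite mem_iota.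
pose I n r := smem r sPoint 0 = 2%:R ^+ n /\
  forall i, (i < n)%N -> smem r sSeq i = f.[2%:R ^+ i].
suff [] : I (nmem s nPoints 0) (sem eval_points s) by [].
rewrite /eval_points sem_seq; apply: (for_ind (I := I)); [by [] | by [] | by split |].
move=> k r kN rk hN hS [rx IH].
have ldr : loaded P r.
  by move=> i iP; have [h1 h2 h3 h4] := ld i iP; split; mem.
have lenr : nmem r nLen 0 = size P by mem.
split; first by mem; rewrite rx exprS mulr_natl mulr2n.
move=> i; rewrite ltnS => ik; mem; rewrite rk sL.
case: eqVneq => [->|ne]; last by apply: IH; rewrite ltn_neqAle ne.
rewrite (eval_slpP wf) // ?rx ?subn1 ?prednK //.
by rewrite -Pf -nth_last -/(slp_values P) size_slp_values.
Qed.

(** * Recovery of exponents and coefficients *)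

Lemma find_exponentsP s (es : seq nat) :
  let L := nmem s nLen 0 in let s' := sem find_exponents s in
  nmem s nBits 0 = L.+1 ->
  (forall k, (k <= L)%N -> smem s sPow k = (2 ^ (2 ^ k))%:R /\ nmem s nPow k = (2 ^ k)%N) ->
  sorted gtn es -> {in es, forall e, e < 2 ^ L.+1}%N ->
  ((0 < size es)%N -> - smem s sRow (nmem s nLast 0 + nmem s nRank 0 - 1) =
     (\sum_(e <- es) 2 ^ e)%:R) ->
  forall i, (i < nmem s nTerms 0)%N -> (i < size es)%N ->
  nmem s' 1 i = nth 0%N es i /\ smem s' sRoot i = (2 ^ nth 0%N es i)%:R.
Proof.
move=> L s' sb pow srt small sum0.
(* Nothing is claimed about [sSum] once the list is exhausted; for an empty list the cell it starts
   from is not even a sum of powers. *)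
pose I j r :=
  ((j < size es)%N -> smem r sSum 0 = (\sum_(e <- drop j es) 2 ^ e)%:R) /\
  forall i, (i < j)%N -> (i < size es)%N ->
  nmem r 1 i = nth 0%N es i /\ smem r sRoot i = (2 ^ nth 0%N es i)%:R.
suff [] : I (nmem s nTerms 0) s' by [].
rewrite /s' /find_exponents sem_seq; apply: (for_ind (I := I)); [by [] | by [] | |].
  by split=> // es0; rewrite drop0; mem; rewrite sub0r sum0.
move=> j r jt rj hN hS [rsum IH].
case: (ltnP j (size es)) => jes; last first.
  split=> [|i ij ies]; first by rewrite ltnNge (leqW jes).
  have ji : (i < j)%N by exact: leq_trans jes.
  mem; rewrite rj (ltn_eqF ji); exact: IH.
set e := nth 0%N es j; set n := (\sum_(e <- drop j es) 2 ^ e)%N.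
have nE : n = (2 ^ e + \sum_(d <- drop j.+1 es) 2 ^ d)%N.
  by rewrite /n (drop_nth 0%N jes) big_cons.
have pth : path gtn e (drop j.+1 es).
  by have := drop_sorted j srt; rewrite (drop_nth 0%N jes).
have lt_rest := sum_exp2_lt pth.
have [|||||cur ex] := @find_digitP r n e.
- by mem.
- by move=> k; mem; exact: pow.
- exact: rsum.
- by rewrite nE leq_addr expnS mul2n -addnn ltn_add2l.
- by mem; apply: small; rewrite mem_nth.
split=> [j'|i]; mem.
  by rewrite rsum // cur -/n nE natrD addrC addKr.
rewrite ltnS leq_eqVlt rj => /predU1P[->|ij] ies; first by rewrite eqxx cur ex.
by rewrite (ltn_eqF ij); exact: IH.
Qed.

Lemma find_coefficientP s (f : {poly F}) e :
  let t := nmem s nTerms 0 in let s' := sem find_coefficient s in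
  smem s sRoot (nmem s nJ 0) = node F e ->
  (forall l, (l <= t)%N -> smem s sRow (nmem s nLast 0 + l) = (locator f)`_l) ->
  (forall i, (i < t)%N -> smem s sSeq i = f.[2%:R ^+ i]) ->
  smem s' sNum 0 = \sum_(i < t) horner_quo f t (node F e) (t - i) * f.[2%:R ^+ i] /\
  smem s' sDen 0 = \sum_(i < t) horner_quo f t (node F e) (t - i) * node F e ^+ i.
Proof.
move=> t s' root row sq; set x := node F e in root *; set h := horner_quo f t x.
pose I k r := [/\ smem r sQuo 0 = h k,
  smem r sNum 0 = \sum_(i < k) h i.+1 * f.[2%:R ^+ (t - i.+1)]
  & smem r sDen 0 = \sum_(i < k) h i.+1 * x ^+ (k - i.+1)].
suff [_ -> ->] : I t s'.
  (* The pass meets the quotient coefficients from the top degree down, the sums are indexed from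
     degree 0 up. *)
  by split; rewrite [RHS](reindex_inj rev_ord_inj) /=; apply: eq_bigr => i _;
    rewrite (_ : t - (t - i.+1) = i.+1)%N // subKn.
rewrite /s' /find_coefficient 3!sem_seq; apply: (for_ind (I := I)); [by [] | by [] | |].
  by split; mem; rewrite ?big_ord0.
move=> k r kt rk hN hS [r1 r2 r3].
have q : smem s sRow (nmem s nLast 0 + (t - k)) + x * h k = h k.+1.
  by rewrite row ?leq_subr.
split; mem; rewrite rk -/t root r1 q //.
  rewrite big_ord_recr r2 /= sq; first by rewrite subn1 -subnS.
  by rewrite subn1 -subnS; lia.
rewrite big_ord_recr r3 /= subnn expr0 mulr1; congr (_ + _).
rewrite mulr_suml; apply: eq_bigr => i _.
by rewrite -mulrA -exprSr -subSn.
Qed.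

Lemma find_coefficientsP s (f : {poly F}) (es : seq nat) :
  let t := nmem s nTerms 0 in let s' := sem find_coefficients s in
  (forall i, (i < size es)%N -> smem s sRoot i = node F (nth 0%N es i)) ->
  (forall l, (l <= t)%N -> smem s sRow (nmem s nLast 0 + l) = (locator f)`_l) ->
  (forall i, (i < t)%N -> smem s sSeq i = f.[2%:R ^+ i]) ->
  nomial t f -> es = support f ->
  forall i, (i < size es)%N -> smem s' 0 i = f`_(nth 0%N es i).
Proof.
move=> t s' root row sq ft esE.
pose I j r := forall i, (i < j)%N -> (i < size es)%N -> smem r 0 i = f`_(nth 0%N es i).
suff h : I t s' by move=> i ies; apply: h => //; rewrite (leq_trans ies) // esE size_support.
apply: (for_ind (I := I)); [by [] | by [] | by [] |].
move=> j r jt rj hN hS IH i; rewrite ltnS leq_eqVlt => ij ies.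
mem; rewrite rj; move: ij => /predU1P[ij|ij]; last first.
  by rewrite (ltn_eqF ij); exact: IH.
rewrite -ij eqxx; set e := nth 0%N es i.
have [|||num den] := @find_coefficientP r f e.
- by mem; rewrite rj -ij root.
- by move=> l; mem; exact: row.
- by move=> l; mem; exact: sq.
rewrite num den (_ : nmem r nTerms 0 = t); last by mem.
by apply: quotient_coef => //; rewrite -esE mem_nth.
Qed.

(** Functionals i < t on degrees l at most t involve s_(i+l) with i + l at most 2t - 1, whence the
    2t evaluation points. *)
Lemma echelon_rows (f : {poly F}) t (sq row d : nat -> F) (v : nat -> nat) :
  (forall i, (i < t + t)%N -> sq i = f.[2%:R ^+ i]) ->
  rows_reduced t.+1 t sq row d v t.+1 ->
  echelon f t (fun k => \poly_(l < t.+1) row (k * t.+1 + l)%N) d v.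
Proof.
pose p k := \poly_(l < t.+1) row (k * t.+1 + l)%N; rewrite -/p => sqE red k kt.
have dotE i j : (i < t)%N -> shifted f i (p j) = dot t.+1 sq row (j * t.+1) i.
  move=> it; rewrite (shifted_coef _ _ (size_poly _ _)); apply: eq_bigr => l _.
  by rewrite coef_poly ltn_ord sqE // -addSn leq_add // -ltnS.
have [h1 h2 h3 h4 h5] := red k kt.
have pk : (p k)`_k = 1 by rewrite coef_poly ltnS kt.
have sp : size (p k) = k.+1.
  apply/eqP; rewrite eqn_leq; apply/andP; split.
    apply/leq_sizeP => l kl; rewrite coef_poly; case: ltnP => // lt.
    by rewrite h2 // kl.
  by rewrite ltnNge; apply/negP => /leq_sizeP/(_ k (leqnn k))/eqP; rewrite pk oner_eq0.
split=> //.
- by rewrite monicE /lead_coef sp pk.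
- by move=> d0 i it; rewrite dotE // h3.
- by move=> /h4[vt <-]; rewrite dotE.
move=> j jk dj; have [_ _ _ h _] := red j (ltnW (leq_trans jk kt) : j < t.+1)%N.
by have [vt _] := h dj; rewrite dotE // h5.
Qed.

End Blocks.

Lemma sparse_interpolationP (F : numFieldType) (P : slp F) (t : nat) (f : {poly F}) :
  (0 < t)%N -> slp_represents P f -> nomial t f ->
  exists n s, [/\ exec sparse_interpolation (input P t) n s,
    monomial_expansion (output s) f & (n <= 3000 * (t ^ 4 * size P))%N].
Proof.
move=> t0 Pf ft; have [/andP[P0 /allP wf'] Pl] := Pf.
have wf k : (k < size P)%N -> slp_instr_wf k (nth SVar P k).
  by move=> kP; apply: wf'; rewrite mem_iota.
set L := size P in P0 *; set s0 := sem bounds (input P t).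
have [n1 e1 c1] : exists2 n, exec (compile bounds) (input P t) n s0 & (n <= 100)%N.
  have [//|//|n e c] := @exec_compile F [::] (fun=> 0%N) bounds (input P t).
  by exists n => //; apply: leq_trans c _.
have [s0L s0t s0w s0p s0b] : [/\ nmem s0 nLen 0 = L, nmem s0 nTerms 0 = t,
    nmem s0 nWidth 0 = t.+1, nmem s0 nPoints 0 = (t + t)%N & nmem s0 nBits 0 = L.+1].
  by split; rewrite /s0 /bounds; mem; rewrite ?addn1.
have [b|n2 e2 c2] := @exec_compile F bound_arrays (bound_values L t) main s0 main_bounded.
  by rewrite !inE => /or4P[|||/orP[]] /eqP ->.
exists (n1 + n2)%N, (sem main s0); split; first exact: ExecSeq e1 e2.
  2: by have := main_cost t0 P0; lia.
have ld0 : loaded P s0.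
  move=> k kP; split; rewrite /s0 /bounds; mem; exact: (nth_map SVar).
rewrite /main 6!sem_seq.
set s1 := sem eval_points s0; set s2 := sem eliminate s1; set s3 := sem find_rank s2.
set s4 := sem powers s3; set s5 := sem find_exponents s4.
set s6 := sem find_coefficients s5.
have sq1 i : (i < t + t)%N -> smem s1 sSeq i = f.[2%:R ^+ i].
  by move=> it; apply: (eval_pointsP Pf ld0 s0L); rewrite s0p.
have w1 : nmem s1 nWidth 0 = t.+1 by rewrite /s1; mem.
have t1 : nmem s1 nTerms 0 = t by rewrite /s1; mem.
have row1 a : smem s1 sRow a = 0 by rewrite /s1 /s0 /bounds; mem.
have := @eliminateP F s1; rewrite /= w1 t1 -/s2 => /(_ erefl row1) red.
have ech := echelon_rows sq1 red.
set es := support f; set m := size es.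
have mt : (m <= t)%N by exact: size_support.
have loc := echelon_locator ft ech.
(* A nonzero entry would be the value of a functional at row m, which is the locator and is killed
   by all of them. *)
have dm : smem s2 sDiag m = 0.
  have [_ _ _ h _] := ech m mt; apply/eqP/negPn/negP => dm.
  by have := h dm; rewrite loc shifted_locator => /esym/eqP; exact/negP.
have w2 : nmem s2 nWidth 0 = t.+1 by rewrite /s2; mem.
have t2 : nmem s2 nTerms 0 = t by rewrite /s2; mem.
have := @find_rankP F s2 m; rewrite /= t2 w2 -/s3.
move=> /(_ mt (fun j => @echelon_diag _ _ _ ft _ _ _ ech j) dm) [rank3 last3].
have row l : (l <= t)%N -> smem s2 sRow (m * t.+1 + l)%N = (locator f)`_l.
  by move=> lt; rewrite -loc coef_poly ltnS lt.
have pow4 k : (k <= L)%N ->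
    smem s4 sPow k = (2 ^ (2 ^ k))%:R /\ nmem s4 nPow k = (2 ^ k)%N.
  by move=> kL; apply: powersP; rewrite /s3 /s2 /s1; mem; rewrite s0L.
have L4 : nmem s4 nLen 0 = L by rewrite /s4 /s3 /s2 /s1; mem.
have t4 : nmem s4 nTerms 0 = t by rewrite /s4 /s3; mem.
have rank4 : nmem s4 nRank 0 = m by rewrite /s4; mem.
have last4 : nmem s4 nLast 0 = (m * t.+1)%N by rewrite /s4; mem.
have small : {in es, forall e, e < 2 ^ L.+1}%N.
  move=> e; rewrite mem_support => fe.
  have := size_slp_value wf (_ : L.-1 < L)%N; rewrite prednK // => /(_ (leqnn L)).
  rewrite (_ : (slp_values P)`_L.-1 = f); last first.
    by rewrite -Pl -nth_last -/(slp_values P) size_slp_values.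
  move=> fs.
  have : (e < size f)%N by rewrite ltnNge; apply: contraNN fe => /(nth_default 0) ->.
  move=> /leq_trans/(_ fs); rewrite ltnS => /leq_ltn_trans; apply.
  by rewrite ltn_exp2l //; lia.
have b4 : nmem s4 nBits 0 = L.+1 by rewrite /s4 /s3 /s2 /s1; mem.
have row4 a : smem s4 sRow a = smem s2 sRow a by rewrite /s4 /s3; mem.
(* The address points to the coefficient of degree m - 1 in row m; [0 < m] keeps the truncated
   subtraction exact. *)
have sum4 : (0 < m)%N -> - smem s4 sRow (m * t.+1 + m - 1) = (\sum_(e <- es) 2 ^ e)%:R.
  move=> m0; rewrite row4 -addnBA // row ?subn1 ?locator_sum //.
  exact: leq_trans (leq_pred _) mt.
have := @find_exponentsP F s4 es; rewrite /= L4 t4 rank4 last4 -/s5.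
move=> /(_ b4 pow4 (support_sorted f) small sum4) exps.
have t5 : nmem s5 nTerms 0 = t by rewrite /s5; mem.
have last5 : nmem s5 nLast 0 = (m * t.+1)%N by rewrite /s5; mem.
have root5 i : (i < m)%N -> smem s5 sRoot i = node F (nth 0%N es i).
  by move=> im; have [_ ->] := exps i (leq_trans im mt) im.
have row5 l : (l <= t)%N -> smem s5 sRow (m * t.+1 + l) = (locator f)`_l.
  by move=> lt; rewrite /s5; mem; rewrite row4 row.
have sq5 i : (i < t)%N -> smem s5 sSeq i = f.[2%:R ^+ i].
  by move=> it; rewrite /s5 /s4 /s3 /s2; mem; rewrite sq1 // ltn_addr.
have := @find_coefficientsP F s5 f es; rewrite /= t5 last5 -/s6.
move=> /(_ root5 row5 sq5 ft erefl) coefs.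
rewrite sem_n; mem.
have -> : output (setn s6 0 0 (nmem s6 nRank 0)) = [seq (f`_e, e) | e <- es].
  rewrite /output nmem_setn eqxx (_ : nmem s6 nRank 0 = m); last by rewrite /s6 /s5; mem.
  apply: (@eq_from_nth _ (0, 0%N)); rewrite !size_map size_iota // => i im.
  rewrite (nth_map 0%N) ?size_iota // nth_iota // add0n (nth_map 0%N) //; mem.
  by rewrite coefs // /s6; mem; have [-> _] := exps i (leq_trans im mt) im.
exact: expansion_support.
Qed.

Theorem theorem3p1 (R : realType) :
  exists (A : cmd) (K : nat),
    forall (L t : nat) (P : slp R[i]) (f : {poly R[i]}),
      (0 < t)%N -> size P = L -> slp_represents P f -> nomial t f ->
      exists (n : nat) (s : state R[i]),
        [/\ exec A (input P t) n s,
            monomial_expansion (output s) f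
          & (n <= K * (t ^ 4 * L))%N].

Proof.
exists sparse_interpolation, 3000%N => L t P f t0 <- Pf ft.
exact: sparse_interpolationP.
Qed.
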